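(* Let $G$ be a graph and $\kappa$ be an infinite cardinal. Then $L(\Omega(G))\leq \kappa$ if, and only if, for every finite set $F\subseteq V(G)$, at most $\kappa$ many connected components of $G\setminus F$ contain rays.
   Context: A graph is a pair $G=(V(G),E(G))$ with $V(G)$ an arbitrary set and $E(G)\subseteq [V(G)]^2$ (two-element subsets). A ray in $G$ is an injective sequence of vertices $(v_0,v_1,\dots)$ with $\{v_i,v_{i+1}\}\in E(G)$ for all $i$; a tail of it is $(v_n,v_{n+1},\dots)$ for some $n$. For finite $F\subseteq V(G)$, $G\setminus F$ is the subgraph induced on $V(G)\setminus F$; a connected component is a maximal connected subgraph. Two rays of $G$ are equivalent if for every finite $F\subseteq V(G)$ they have tails lying in the same connected component of $G\setminus F$. An end is an equivalence class of rays, and $\Omega(G)$ is the set of ends. For an end $\epsilon$ and finite $F\subseteq V(G)$, $G(\epsilon,F)$ is the unique connected component of $G\setminus F$ containing a tail of every ray of $\epsilon$, and $\Omega(\epsilon,F)$ is the set of all ends having a ray contained in $G(\epsilon,F)$. A set $U\subseteq\Omega(G)$ is open if for every $\epsilon\in U$ there is a finite $F\subseteq V(G)$ with $\Omega(\epsilon,F)\subseteq U$; this topologizes $\Omega(G)$, the end space of $G$. The Lindelöf degree $L(X)$ of a space $X$ is the least infinite cardinal $\kappa$ such that every open cover of $X$ has a subcover of cardinality at most $\kappa$. *)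

(* Defs.v *)
From HB Require Import structures.
From mathcomp Require Import all_boot all_order.
From mathcomp Require Import all_classical.
From mathcomp Require Import topology.

Set Implicit Arguments.
Unset Strict Implicit.
Unset Printing Implicit Defensive.

Local Open Scope classical_set_scope.
Local Open Scope card_scope.

(* The vertex set is an arbitrary subset of an ambient type, so that a graph
   and its subgraphs have the same type. *)
Record graph (T : Type) := Graph {
  vertices : set T;
  edges : set (set T);
  edgesP : forall e, edges e -> exists x y,
    [/\ vertices x, vertices y, x <> y & e = [set x; y]]
}.

Section Graphs.
Context {T : Type}.
Implicit Types (G H C D : graph T) (F W : set T) (r s : nat -> T).

Definition adj G : rel T := fun x y => `[< edges G [set x; y] >].

Definition subgraph H G := vertices H `<=` vertices G /\ edges H `<=` edges G.

Lemma induced_edgesP G W e : [set e | edges G e /\ e `<=` W] e ->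
  exists x y, [/\ (vertices G `&` W) x, (vertices G `&` W) y, x <> y &
                  e = [set x; y]].
Proof.
move=> [/edgesP[x [y [Vx Vy xy ->]]] sW].
by exists x, y; split => //; split => //; apply: sW; [left|right].
Qed.

Definition induced G W : graph T := Graph (@induced_edgesP G W).

Definition delete G F : graph T := induced G (~` F).

Definition connected_graph G :=
  vertices G !=set0 /\
  forall x y, vertices G x -> vertices G y ->
    exists2 p : seq T, path (adj G) x p & y = last x p.

Definition component G C :=
  [/\ subgraph C G, connected_graph C &
      forall D, subgraph D G -> connected_graph D -> subgraph C D -> D = C].

Definition ray G r := injective r /\ forall i, edges G [set r i; r i.+1].

Definition tail n r : nat -> T := fun i => r (n + i).

Definition contains_ray G := exists r, ray G r.

Definition ray_equiv G r s :=
  forall F, finite_set F -> F `<=` vertices G ->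
    exists C, [/\ component (delete G F) C,
                  exists m, ray C (tail m r) & exists n, ray C (tail n s)].

Definition is_end G (e : set (nat -> T)) :=
  exists2 r, ray G r & e = [set s | ray G s /\ ray_equiv G r s].

End Graphs.

Record end_space (T : Type) (G : graph T) := End {
  end_rays : set (nat -> T);
  end_raysP : is_end G end_rays
}.

HB.instance Definition _ T (G : graph T) := gen_eqMixin (end_space G).
HB.instance Definition _ T (G : graph T) := gen_choiceMixin (end_space G).

(* The relation [C = G(e, F)]; see [end_component_exists] and
   [end_component_unique]. *)
Definition end_component T (G : graph T) (e : end_space G) (F : set T)
    (C : graph T) :=
  component (delete G F) C /\ forall r, end_rays e r -> exists n, ray C (tail n r).

(* [Omega(e, F)] *)
Definition end_nbhd T (G : graph T) (e : end_space G) (F : set T) :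
    set (end_space G) :=
  [set d | exists2 C, end_component e F C & exists2 r, end_rays d r & ray C r].

Definition end_open T (G : graph T) (U : set (end_space G)) :=
  forall e, U e -> exists F : set T,
    [/\ finite_set F, F `<=` vertices G & end_nbhd e F `<=` U].

Section EndTopology.
Context {T : Type}.
Implicit Types (G H C D : graph T) (F W : set T) (r s : nat -> T).

Lemma adj_sym G : symmetric (adj G).
Proof. by move=> x y; rewrite /adj setUC. Qed.

Lemma adj_vertices G x y : adj G x y -> vertices G x /\ vertices G y.
Proof.
move=> /asboolP exy; have [a [b [Va Vb _ E]]] := edgesP exy.
have xV z : [set x; y] z -> vertices G z by rewrite E => -[]->.
by split; apply: xV; [left|right].
Qed.

Lemma graph_eq G H : subgraph G H -> subgraph H G -> G = H.
Proof.
case: G H => [V E P] [V' E' P'] [/= VV EE] [/= VV' EE'].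
have ? : V = V' by apply/seteqP.
have ? : E = E' by apply/seteqP.
by subst V' E'; congr Graph; apply: Prop_irrelevance.
Qed.

Lemma subgraph_trans G H C : subgraph G H -> subgraph H C -> subgraph G C.
Proof. move=> [a b] [c d]; by split; [apply: subset_trans c|apply: subset_trans d]. Qed.

Lemma sub_ray H G r : subgraph H G -> ray H r -> ray G r.
Proof. by move=> [_ sE] [ri rE]; split => // i; apply: sE. Qed.

Lemma adj_path H G x p : subgraph H G -> path (adj H) x p -> path (adj G) x p.
Proof. by move=> [_ sE]; apply: sub_path => a b /asboolP ab; apply/asboolP; exact: sE. Qed.

Lemma sub_delete G F F' : F `<=` F' -> subgraph (delete G F') (delete G F).
Proof.
move=> sF; split=> [x [Vx nFx]|e [Ee sW]]; first by split=> // /sF.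
by split=> // x /sW nF' /sF.
Qed.

Definition component_of G x : graph T :=
  induced G [set y | exists2 p, path (adj G) x p & y = last x p].

Lemma sub_component_of G D x : subgraph D G -> connected_graph D ->
  vertices D x -> subgraph D (component_of G x).
Proof.
move=> sDG [_ Dc] Dx.
have Dreach y : vertices D y -> exists2 p, path (adj G) x p & y = last x p.
  by move=> Dy; have [p xp ->] := Dc _ _ Dx Dy; exists p => //;
    apply: adj_path xp.
split=> [y Dy|e De]; first by split; [apply: sDG.1|apply: Dreach].
split; first exact: sDG.2.
by have [a [b [Va Vb _ ->]]] := edgesP De => t [->|->]; apply: Dreach.
Qed.

Lemma component_ofP G x : vertices G x -> component G (component_of G x).
Proof.
move=> Gx; set C := component_of G x.
have Cx : vertices C x by split=> //; exists [::].
have Cpath p z q : path (adj G) x q -> z = last x q ->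
    path (adj G) z p -> path (adj C) z p.
  elim: p z q => //= y p IH z q xq zq /andP[zy yp].
  have xqy : path (adj G) x (rcons q y) by rewrite rcons_path xq -zq.
  apply/andP; split; last by apply: IH xqy _ yp; rewrite last_rcons.
  apply/asboolP; split; first exact/asboolP.
  move=> t [->|->]; first by exists q.
  by exists (rcons q y) => //; rewrite last_rcons.
split.
- by split=> [y []|e []].
- split; first by exists x.
  have sym : symmetric (adj C) by exact: adj_sym.
  move=> y z [_ [p xp yE]] [_ [q xq zE]].
  have xp' := Cpath p x [::] isT erefl xp.
  have xq' := Cpath q x [::] isT erefl xq.
  have lastE : last y (rev (belast x p)) = x.
    by case: p yE {xp xp'} => [->|a p _] //=; rewrite rev_cons last_rcons.
  exists (rev (belast x p) ++ q); last by rewrite last_cat lastE.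
  rewrite cat_path lastE xq' andbT yE rev_path.
  by rewrite (@eq_path _ _ (adj C)) // => a b; rewrite sym.
- move=> D sDG Dc sCD; apply: graph_eq => //.
  by apply: sub_component_of => //; exact: sCD.1.
Qed.

Lemma component_unique G C x : component G C -> vertices C x ->
  C = component_of G x.
Proof.
move=> [sC Cc Cmax] Cx; apply/esym.
have [sx cx _] := component_ofP (sC.1 _ Cx).
by apply: Cmax => //; exact: sub_component_of.
Qed.

Lemma ray_vertices G r i : ray G r -> vertices G (r i).
Proof.
by move=> [_ rE]; apply: (proj1 (adj_vertices (x := r i) (y := r i.+1) _));
  apply/asboolP.
Qed.

Lemma ray_tail_delete G F r : ray G r -> finite_set F ->
  exists n, ray (delete G F) (tail n r).
Proof.
move=> [ri rE] fF.
have : finite_set (r @^-1` F).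
  by apply: finite_preimage fF => i j _ _; apply: ri.
rewrite /finite_set; move/finite_seqP => [s sE].
pose n := (\max_(i <- s) i).+1; exists n.
have nF i : ~ F (r (n + i)).
  move=> Fi; have : (r @^-1` F) (n + i) by [].
  rewrite sE /= => si.
  have : n + i <= \max_(i <- s) i by apply: (@leq_bigmax_seq _ s xpredT (fun j : nat => j)).
  by rewrite /n addSn ltnNge leq_addr.
split=> [i j /ri /addnI //|i]; split; first by rewrite /tail addnS; apply: rE.
by move=> _ [->|->]; apply: nF.
Qed.

Lemma ray_in_component G r : ray G r -> ray (component_of G (r 0)) r.
Proof.
move=> rG; have [ri rE] := rG; split=> // i; split; first exact: rE.
have rp j : exists2 p, path (adj G) (r 0) p & r j = last (r 0) p.
  elim: j => [|j [p rp jE]]; first by exists [::].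
  exists (rcons p (r j.+1)); last by rewrite last_rcons.
  by rewrite rcons_path rp -jE; apply/asboolP; exact: rE.
by move=> _ [->|->]; apply: rp.
Qed.

Lemma end_component_exists G (e : end_space G) F :
  finite_set F -> F `<=` vertices G -> exists C, end_component e F C.
Proof.
move=> fF FV; have [r rG eE] := end_raysP e.
have [n rn] := ray_tail_delete rG fF.
exists (component_of (delete G F) (tail n r 0)).
split; first by apply: component_ofP; exact: ray_vertices rn.
move=> s; rewrite eE => -[sG /(_ F fF FV)[C [cC [m rm] [k sk]]]]; exists k.
have Cv : vertices C (r (m + n)) by exact: (ray_vertices n rm).
have rn' := ray_in_component rn.
have cn := component_ofP (ray_vertices 0 rn).
rewrite (component_unique cn (ray_vertices m rn')) /tail addnC.
by rewrite -(component_unique cC Cv).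
Qed.

Lemma end_component_unique G (e : end_space G) F C D :
  end_component e F C -> end_component e F D -> C = D.
Proof.
move=> [cC eC] [cD eD].
have [r er] : exists r, end_rays e r.
  have [r rG ->] := end_raysP e; exists r; split=> // F' fF' _.
  have [n rn] := ray_tail_delete rG fF'.
  exists (component_of (delete G F') (tail n r 0)).
  have rn' := ray_in_component rn.
  by split; [apply: component_ofP; exact: ray_vertices rn|exists n|exists n].
have [m /(ray_vertices^~ _) rC] := eC _ er.
have [n /(ray_vertices^~ _) rD] := eD _ er.
have := rC n; have := rD m; rewrite /tail addnC => Dv Cv.
by rewrite (component_unique cC Cv) (component_unique cD Dv).
Qed.

Lemma sub_end_nbhd G (e : end_space G) F F' : F `<=` F' ->
  end_nbhd e F' `<=` end_nbhd e F.
Proof.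
move=> sF d [C [[sC Cc _] eC] [r dr Cr]].
have [x Cx] := Cc.1; pose C' := component_of (delete G F) x.
have sC' := subgraph_trans sC (sub_delete G sF).
have sCC' : subgraph C C' by exact: sub_component_of.
have compC' : component (delete G F) C' by apply: component_ofP; exact: sC'.1.
exists C'; last by exists r => //; apply: sub_ray Cr.
split=> // s /eC[n Cs]; exists n; exact: sub_ray Cs.
Qed.

Lemma end_openT G : end_open [set: end_space G].
Proof. by move=> e _; exists set0; split. Qed.

Lemma end_openI G : setI_closed (@end_open T G).
Proof.
move=> U U' oU oU' e [/oU[F [fF FV FU]] /oU'[F' [fF' FV' FU']]].
exists (F `|` F'); split; first by rewrite finite_setU.
  by move=> x [/FV|/FV'].
move=> d dF; split; [apply: FU|apply: FU']; move: d dF; apply: sub_end_nbhd.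
  exact: subsetUl.
exact: subsetUr.
Qed.

Lemma end_open_bigcup G (I : Type) (f : I -> set (end_space G)) :
  (forall i, end_open (f i)) -> end_open (\bigcup_i f i).
Proof.
move=> of_ e [i _ /of_[F [fF FV Ff]]]; exists F; split=> // d /Ff fd.
by exists i.
Qed.

End EndTopology.

HB.instance Definition _ T (G : graph T) :=
  isOpenTopological.Build (end_space G)
    (@end_openT T G) (@end_openI T G) (@end_open_bigcup T G).

Lemma open_endE T (G : graph T) (U : set (end_space G)) :
  open U = end_open U.
Proof. by []. Qed.

(* Cardinals are represented by types, compared with [#<=] on their full sets. *)
Definition has_subcovers (X : topologicalType) (K : Type) :=
  forall U : set (set X),
    (forall A, U A -> open A) -> \bigcup_(A in U) A = setT ->
    exists U' : set (set X),
      [/\ U' `<=` U, \bigcup_(A in U') A = setT & U' #<= [set: K]].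

Definition is_lindelof_degree (X : topologicalType) (L : Type) :=
  [/\ infinite_set [set: L], has_subcovers X L &
      forall K : Type, infinite_set [set: K] -> has_subcovers X K ->
        [set: L] #<= [set: K]].

Definition lindelof_degree_le (X : topologicalType) (K : Type) :=
  exists2 L : Type, is_lindelof_degree X L & [set: L] #<= [set: K].

(* Main.v *)
Require Import Defs.
From mathcomp Require Import all_boot all_order.
From mathcomp Require Import finmap.
From mathcomp Require Import all_classical.
From mathcomp Require Import topology.

(**
If every open cover has a subcover of size at most kappa, apply this to the
cover of the end space by the sets of ends living in the components of
[delete G F]: these sets are open, pairwise disjoint and, for a component
with a ray, nonempty, so no component with a ray can be dropped.

For the converse fix an open cover and call a set of vertices small if the
ends with a ray in it are covered by at most kappa members of the cover.
Assume that the whole vertex set is not small. Two facts drive the argument.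
- Splitting ([not_small_split]): if W is not small and has finite boundary,
  and F is finite, then some component D of the graph minus F and the
  boundary of W lies in W and is not small. Otherwise at most kappa small
  components would exhaust the ends of W, and kappa * kappa = kappa.
- Locality ([ray_leaves_not_small]): every ray has a finite set F such that
  the component of [delete G F] holding its tails has only small subsets, by
  openness of a member of the cover that contains its end.
These two are contradictory, whatever not small means ([not_bad_vertices]).
By splitting build C_0, C_1, ... decreasing, connected, not small, with finite
boundaries, together with finite connected sets X_m in C_m that touch every
boundary vertex of C_m and are disjoint from C_(m+1). Each X_m is
linked to X_(m+1) by a path in C_m minus C_(m+2), and any given finite set F
misses almost all of these paths. So there is a ray r such that, for each
finite F, the tails of r and almost all X_m share a component of [delete G F]
([descent_ray]). Let K be the intersection of all C_m.
Take F for r by locality, and let Q be the component of the tails of r. For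
large n split C_n along F: this yields D, not small, hence disjoint from Q.
Since almost all X_m lie in Q and touch the boundary of C_m, that boundary
avoids D; as D is adjacent to a vertex of F in K, it follows that D is inside
every C_m.

The contradiction comes from choosing C_(m+1) greedily, with a boundary as
small as possible. As D competes in almost every choice, the boundaries have
at most as many vertices as that of D. Hence the set S of vertices that lie in
the boundary of C_m for almost all m is finite, and S is contained in the
boundary of C_M for some M. But K is nonempty and C_M is connected and not
contained in K, so some edge of C_M leaves K; its end outside K belongs to S,
although C_M does not meet its own boundary.

The Lindelof degree is turned into this covering property by taking a subset
of kappa of least cardinality among those that bound subcovers
([lindelof_degree_leE]).
*)

Set Implicit Arguments.
Unset Strict Implicit.
Unset Printing Implicit Defensive.

Local Open Scope classical_set_scope.
Local Open Scope card_scope.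

(** * Cardinal arithmetic and the Lindelof degree *)

Lemma card_le_map T U (A : set T) (B : set U) (f : T -> U) :
  set_fun A B f -> set_inj A f -> A #<= B.
Proof.
move=> fAB fI.
have /injfunPex[g] : exists2 f : T -> U, set_fun A B f & set_inj A f by exists f.
exact: inj_card_le.
Qed.

Lemma card_le_inj T U (A : set T) (B : set U) : U -> A #<= B ->
  exists2 f : T -> U, set_fun A B f & set_inj A f.
Proof.
elim/Ppointed: U B => U B u; first by have := no (u : U).
by move/pcard_leP/injfunPex.
Qed.

(** Cardinals are well-founded. Take a maximal set A of choice functions of the
family that are pairwise distinct at every index. If for each i some point of
[S i] were missed by A, these points would form one more function; so A maps
onto some [S i], while it injects into every [S j]. *)
Lemma exists_card_min I K (i0 : I) (S : I -> set K) :
  exists i, forall j, S i #<= S j.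
Proof.
pose P (A : set (I -> K)) := (forall f, A f -> forall i, S i (f i)) /\
  forall f g, A f -> A g -> forall i, f i = g i -> f = g.
have [F FP tot|A [[AS AI] maxA]] := @Zorn_bigcup _ P.
  split=> [f [X /FP[XS _] Xf]|f g [X FX Xf] [Y FY Yg]]; first exact: XS.
  have [XY|YX] := tot _ _ FX FY.
    by apply: (FP _ FY).2 => //; exact: XY.
  by apply: (FP _ FX).2 => //; exact: YX.
have [i iS] : exists i, forall x, S i x -> exists2 f, A f & f i = x.
  apply: contrapT => noi.
  have /choice[g gP] : forall i, exists x, S i x /\ ~ exists2 f, A f & f i = x.
    move=> i; apply: contrapT => nx; apply: noi; exists i => x Sx.
    by apply: contrapT => ?; apply: nx; exists x.
  have newg f : A f -> forall i, f i <> g i.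
    by move=> Af i fgi; apply: (gP i).2; exists f.
  apply: (maxA (A `|` [set g])).
    split; first exact: subsetUl.
    by move=> /(_ g (or_intror erefl)) Ag; exact: (newg g Ag i0).
  split=> [f [/AS//|-> i]|f h [Af|->] [Ah|->] i // E]; first exact: (gP i).1.
  - exact: AI E.
  - by case: (newg f Af i).
  - by case: (newg h Ah i).
exists i => j; apply: (@card_le_trans _ _ _ A).
  apply: card_le_trans (card_image_le (fun f => f i) A).
  by apply: subset_card_le => x /iS[f Af <-]; exists f.
apply: (card_le_map (f := fun f => f j)) => [f /AS//|f g].
by rewrite !inE => Af Ag; exact: AI.
Qed.

(** The two sets are put side by side in a sum type to apply [exists_card_min]. *)
Lemma card_le_total T U (A : set T) (B : set U) : A #<= B \/ B #<= A.
Proof.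
pose S (b : bool) : set (T + U) := if b then inl @` A else inr @` B.
have AE : @inl T U @` A #= A by apply: inj_card_eq => x y _ _ [].
have BE : @inr T U @` B #= B by apply: inj_card_eq => x y _ _ [].
have [[] /=] := exists_card_min true S.
  by move=> /(_ false)/=; rewrite (card_le_eql AE) (card_le_eqr BE); left.
by move=> /(_ true)/=; rewrite (card_le_eql BE) (card_le_eqr AE); right.
Qed.

Section Square.
Variables (K : Type).
Implicit Types (A B : set K) (f g : K -> K -> K).

(** An injection of A * A into A, as a total function so that the carriers can
vary without dependent types. *)
Definition pairing A f :=
  (forall x y, A x -> A y -> A (f x y)) /\
  (forall x y x' y', A x -> A y -> A x' -> A y' -> f x y = f x' y' ->
     x = x' /\ y = y').

(** If the complement of A contains a copy of A, the pairing extends to A and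
that copy: the pairs not in A * A are coded in A, by their A-coordinates and two
marks telling which coordinates are new, and the code is sent to the copy. *)
Lemma pairing_extend A f s t : pairing A f -> A s -> A t -> s <> t ->
  A #<= ~` A -> exists B f', [/\ pairing B f', A `<` B &
    forall x y, A x -> A y -> f' x y = f x y].
Proof.
move=> [fA fI] As At st /(card_le_inj s)[g gA gI].
pose B := A `|` g @` A.
(* u maps the copy back onto A and is the identity on A *)
have /choice[u uP] x : exists y,
    (A x -> y = x) /\ (B x -> A y /\ (~ A x -> g y = x)).
  have [Ax|nAx] := pselect (A x); first by exists x.
  have [[//|[y Ay yx]]|nB] := pselect (B x); last by exists x.
  by exists y.
have uA x : B x -> A (u x) /\ (~ A x -> g (u x) = x) by exact: (uP x).2.
pose tag x := if pselect (A x) is left _ then s else t.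
pose f' x y := if pselect (A x /\ A y) is left _ then f x y
               else g (f (f (u x) (u y)) (f (tag x) (tag y))).
have tagA x : A (tag x) by rewrite /tag; case: pselect.
have tagE x y : tag x = tag y -> (A x <-> A y).
  by rewrite /tag; case: pselect; case: pselect => // ? ? /esym.
have uI x y : B x -> B y -> tag x = tag y -> u x = u y -> x = y.
  move=> Bx By /tagE xy; have [Ax|nAx] := pselect (A x).
    by rewrite (uP x).1 // (uP y).1 //; exact/xy.
  by move=> uE; rewrite -(uA x Bx).2 // uE (uA y By).2 //; rewrite -xy.
have f'E x y : A x -> A y -> f' x y = f x y.
  by move=> Ax Ay; rewrite /f'; case: pselect => // -[].
have codeA x y : B x -> B y -> A (f (f (u x) (u y)) (f (tag x) (tag y))).
move=> Bx By; have ux := (uA x Bx).1; have uy := (uA y By).1.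
  exact: (fA _ _ (fA _ _ ux uy) (fA _ _ (tagA x) (tagA y))).
exists B, f'; split=> //; last first.
  split; first exact: subsetUl.
  by move=> /(_ (g s)) BA; apply: (gA s As); apply: BA; right; exists s.
have f'A x y : B x -> B y -> (A (f' x y) <-> A x /\ A y).
  move=> Bx By; rewrite /f'; case: pselect => [[Ax Ay]|nA].
    by split=> // _; exact: fA.
  by split=> // Ag; case: (gA _ (codeA x y Bx By)).
split=> [x y Bx By|x y x' y' Bx By Bx' By' E].
  rewrite /f'; case: pselect => [[Ax Ay]|_]; first by left; exact: fA.
  by right; eexists; last reflexivity; exact: codeA.
have [[Ax Ay]|nA] := pselect (A x /\ A y).
  have [Ax' Ay'] : A x' /\ A y' by apply/f'A => //; rewrite -E; apply/f'A.
  by move: E; rewrite !f'E // => /(fI _ _ _ _ Ax Ay Ax' Ay').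
have nA' : ~ (A x' /\ A y').
  by move=> A'; apply: nA; apply/f'A => //; rewrite E; apply/f'A.
move: E; rewrite /f'; case: pselect => // _; case: pselect => // _.
move=> /gI; rewrite !inE => /(_ (codeA _ _ Bx By) (codeA _ _ Bx' By')) E.
have uAx z : B z -> A (u z) by move=> /uA[].
have [uE tE] : f (u x) (u y) = f (u x') (u y') /\
    f (tag x) (tag y) = f (tag x') (tag y').
  by apply: fI E; apply/fA => //; exact: uAx.
have [? ?] := fI _ _ _ _ (uAx _ Bx) (uAx _ By) (uAx _ Bx') (uAx _ By') uE.
have [? ?] := fI _ _ _ _ (tagA x) (tagA y) (tagA x') (tagA y') tE.
by split; exact: uI.
Qed.

Lemma pairing_nat : infinite_set [set: K] ->
  exists A f, infinite_set A /\ pairing A f.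
Proof.
move=> /[dup] /infinite_setN0[x0 _] /infiniteP/(card_le_inj x0)[e _ eI].
have {}eI : injective e by move=> i j; apply: eI; rewrite inE.
have [c _ cI] : exists2 c : nat * nat -> nat,
    set_fun setT setT c & set_inj setT c.
  by apply: (card_le_inj 0); have /card_eqPle[] := card_nat2.
have {}cI : injective c by move=> i j; apply: cI; rewrite inE.
have [d dP] : exists d : K -> nat, forall i, d (e i) = i.
  have /choice[d dP] x : exists j, forall i, e i = x -> i = j.
    have [[i <-]|nx] := pselect (exists i, e i = x); first by exists i => j /eI.
    by exists 0 => i ix; case: nx; exists i.
  by exists d => i; apply/esym; exact: dP.
exists (range e), (fun x y => e (c (d x, d y))); split.
  apply/infiniteP; apply: (card_le_map (f := e)); first by move=> i _; exists i.
  by move=> i j _ _ /eI.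
split=> [x y _ _|_ _ _ _ [i _ <-] [j _ <-] [i' _ <-] [j' _ <-]].
  by eexists.
by rewrite !dP => /eI/cI[-> ->].
Qed.

(** Zorn's lemma gives a maximal infinite A with a pairing. By [pairing_extend]
its complement is at most as large as A, so the whole type injects into A,
using pairing with two marks, and inherits a pairing. *)
Lemma exists_pairing : infinite_set [set: K] -> exists f, pairing setT f.
Proof.
move=> infK; have [A0 [f0 [infA0 pf0]]] := pairing_nat infK.
pose P (p : set K * (K -> K -> K)) := infinite_set p.1 /\ pairing p.1 p.2.
pose R (p q : {p | P p}) := `[< (sval p).1 `<=` (sval q).1 /\
  forall x y, (sval p).1 x -> (sval p).1 y ->
    (sval q).2 x y = (sval p).2 x y >].
pose p00 : {p | P p} := exist P (A0, f0) (conj infA0 pf0).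
have [||C tot|[[A f] /= [infA pf]] maxA] := @ZL_preorder _ p00 R.
- by move=> p; apply/asboolP; split.
- move=> p q r /asboolP[pq fpq] /asboolP[qr fqr]; apply/asboolP; split.
    exact: subset_trans qr.
  by move=> x y px py; rewrite fqr ?fpq //; exact: pq.
- have [[p0 Cp0]|nC] := pselect (exists p, C p); last first.
    by exists p00 => s Cs; case: nC; exists s.
  have /choice[f fP] (xy : K * K) : exists z, forall p, C p ->
      (sval p).1 xy.1 -> (sval p).1 xy.2 -> (sval p).2 xy.1 xy.2 = z.
    have [[p [Cp px py]]|nC] := pselect (exists p,
      [/\ C p, (sval p).1 xy.1 & (sval p).1 xy.2]); last first.
      by exists xy.1 => p Cp px py; case: nC; exists p.
    exists ((sval p).2 xy.1 xy.2) => q Cq qx qy.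
    by have [/asboolP[_ ->]|/asboolP[_ ->]] := tot _ _ Cp Cq.
  (* union of a nonempty chain; f agrees with each of its members *)
  pose A := \bigcup_(p in C) (sval p).1.
  have A2 x y : A x -> A y -> exists2 p, C p & (sval p).1 x /\ (sval p).1 y.
    move=> [p Cp px] [q Cq qy].
    by have [/asboolP[pq _]|/asboolP[qp _]] := tot _ _ Cp Cq;
      [exists q => //; split=> //; exact: pq|exists p => //; split=> //; exact: qp].
  have A4 x y x' y' : A x -> A y -> A x' -> A y' ->
      exists2 p, C p & [/\ (sval p).1 x, (sval p).1 y,
                           (sval p).1 x' & (sval p).1 y'].
    move=> Ax Ay Ax' Ay'.
    have [p Cp [px py]] := A2 _ _ Ax Ay; have [q Cq [qx qy]] := A2 _ _ Ax' Ay'.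
    by have [/asboolP[pq _]|/asboolP[qp _]] := tot _ _ Cp Cq;
      [exists q => //; split=> //; exact: pq|exists p => //; split=> //; exact: qp].
  have fE p x y : C p -> (sval p).1 x -> (sval p).1 y ->
      f (x, y) = (sval p).2 x y.
    by move=> Cp px py; apply/esym; exact: (fP (x, y)).
  have PA : P (A, fun x y => f (x, y)).
    split=> /=.
      by apply: sub_infinite_set (svalP p0).1 => x px; exists p0.
    split=> [x y Ax Ay|x y x' y' Ax Ay Ax' Ay'].
      have [p Cp [px py]] := A2 _ _ Ax Ay; exists p => //.
      by rewrite (fE p) //; apply: (svalP p).2.1.
    have [p Cp [px py px' py']] := A4 _ _ _ _ Ax Ay Ax' Ay'.
    by rewrite !(fE p) //; apply: (svalP p).2.2.
  exists (exist P _ PA) => p Cp; apply/asboolP; split=> [x px|x y px py] /=.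
    by exists p.
  exact: fE.
have [e eA eI] : exists2 e : nat -> K, set_fun setT A e & set_inj setT e.
  by have [x _] := infinite_setN0 infA; apply: (card_le_inj x); exact/infiniteP.
have Ae i : A (e i) by exact: eA.
have e01 : e 0 <> e 1 by move=> /(eI _ _ (mem_set I) (mem_set I)).
(* a complement at least as large as A contradicts maximality *)
have [AC|] := card_le_total A (~` A).
  have [B [g [pg [AB nBA] gE]]] := pairing_extend pf (Ae 0) (Ae 1) e01 AC.
  have PB : P (B, g) by split=> //; exact: sub_infinite_set AB infA.
  have /asboolP[/= BA _] := maxA (exist P _ PB) (asboolT (conj AB gE)).
  by case: nBA.
move=> /(card_le_inj (e 0))[g gA gI]; have [fA fI] := pf.
pose h x := if pselect (A x) is left _ then f x (e 0) else f (g x) (e 1).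
have hA x : A (h x).
  by rewrite /h; case: pselect => [Ax|nAx]; apply/fA => //; exact: gA.
have hI : injective h.
  move=> x y; rewrite /h; case: pselect => Ax; case: pselect => Ay E.
  - by have [] := fI _ _ _ _ Ax (Ae 0) Ay (Ae 0) E.
  - by have [_ /e01] := fI _ _ _ _ Ax (Ae 0) (gA _ Ay) (Ae 1) E.
  - by have [_ /esym/e01] := fI _ _ _ _ (gA _ Ax) (Ae 1) Ay (Ae 0) E.
  - have [gE _] := fI _ _ _ _ (gA _ Ax) (Ae 1) (gA _ Ay) (Ae 1) E.
    by apply: gI gE; rewrite inE.
exists (fun x y => f (h x) (h y)); split=> // x y x' y' _ _ _ _ E.
by have [/hI -> /hI ->] := fI _ _ _ _ (hA x) (hA y) (hA x') (hA y') E.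
Qed.

End Square.

Lemma card_bigcup_le I U K (D : set I) (F : I -> set U) :
  infinite_set [set: K] -> D #<= [set: K] ->
  (forall i, D i -> F i #<= [set: K]) ->
  \bigcup_(i in D) F i #<= [set: K].
Proof.
move=> infK DK FK; have [f [_ fI]] := exists_pairing infK.
have [x0 _] := infinite_setN0 infK.
have [d _ dI] := card_le_inj x0 DK.
have /choice[c cP] i : exists c : U -> K, D i -> set_inj (F i) c.
  have [Di|nD] := pselect (D i); last by exists (fun=> x0).
  by have [c _ cI] := card_le_inj x0 (FK i Di); exists c.
have [[i0 _]|nI] := pselect (exists i : I, True); last first.
  by rewrite bigcup0 ?card_ge0 // => i _; case: nI; exists i.
have /choice[s sP] u : exists i, (\bigcup_(i in D) F i) u -> D i /\ F i u.
  have [[i Di Fu]|nu] := pselect ((\bigcup_(i in D) F i) u); first by exists i.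
  by exists i0.
apply: (card_le_map (f := fun u => f (d (s u)) (c (s u) u))) => // u v.
rewrite !inE => /sP[Du Fu] /sP[Dv Fv] fE.
have [|||| dE cE] := fI _ _ _ _ _ _ _ _ fE => //.
have sE : s u = s v by apply: dI dE; rewrite inE.
by rewrite -sE in Fv cE; apply: (cP _ Du) cE; rewrite inE.
Qed.

Lemma has_subcovers_le (X : topologicalType) K K' :
  [set: K] #<= [set: K'] -> has_subcovers X K -> has_subcovers X K'.
Proof.
move=> KK' XK U oU cU; have [U' [U'U cU' U'K]] := XK U oU cU.
by exists U'; split=> //; exact: card_le_trans KK'.
Qed.

(** From right to left the content is that a least bound exists. It suffices to
minimize over subsets of K: by comparability, any type either is at least as
large as K or has the size of a subset of K. *)
Lemma lindelof_degree_leE (X : topologicalType) K : infinite_set [set: K] ->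
  lindelof_degree_le X K <-> has_subcovers X K.
Proof.
move=> infK; split=> [[L [_ XL _] LK]|XK]; first exact: has_subcovers_le XL.
pose I := {S : set K | infinite_set S /\ has_subcovers X S}.
have ST : infinite_set [set: K] /\ has_subcovers X [set: K].
  split=> //; apply: has_subcovers_le XK.
  by have /card_eqPle[] := card_setT [set: K].
have [[S [infS XS]] /= minS] :=
  exists_card_min (exist _ _ ST : I) (@sval _ _).
have Sset := card_setT S.
exists S; last by rewrite (card_le_eql Sset); exact: card_leT.
split=> // [|K' infK' XK'].
  by move/infiniteP: infS => infS; apply/infiniteP; rewrite (card_le_eqr Sset).
rewrite (card_le_eql Sset).
have [KK'|] := card_le_total [set: K] [set: K'].
  exact: card_le_trans (card_leT _) KK'.
have [x0 _] := infinite_setN0 infK.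
move=> /(card_le_inj x0)[f _ /inj_card_eq fE].
have K'f : [set: K'] #<= range f by have /card_eqPle[] := fE.
have fP : infinite_set (range f) /\ has_subcovers X (range f).
  split.
    move/infiniteP: infK' => ?; apply/infiniteP.
    exact: card_le_trans K'f.
  by apply: has_subcovers_le XK'; rewrite (card_le_eqr (card_setT _)).
by have := minS (exist _ _ fP); rewrite /= (card_le_eqr fE).
Qed.

(** * Connected vertex sets, boundaries and components *)

Section Connectedness.
Context {T : Type}.
Implicit Types (G H C D : graph T) (F W A X : set T) (r s : nat -> T).

Lemma path_exit H A x p : path (adj H) x p -> A x -> ~ A (last x p) ->
  exists u v, [/\ A u, ~ A v & adj H u v].
Proof.
elim: p x => //= y p IH x /andP[xy yp] Ax nA.
by have [Ay|nAy] := pselect (A y); [exact: IH Ay nA|exists x, y].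
Qed.

Lemma path_stay H A x p : (forall u v, A u -> adj H u v -> A v) ->
  path (adj H) x p -> A x -> A (last x p).
Proof.
move=> clA xp Ax; apply: contrapT => nA.
by have [u [v [Au nAv uv]]] := path_exit xp Ax nA; exact: nAv (clA u v Au uv).
Qed.

Lemma adj_induced G W u v : adj (induced G W) u v <-> [/\ adj G u v, W u & W v].
Proof.
split=> [/asboolP[Euv sW]|[/asboolP Euv Wu Wv]].
  by split; [apply/asboolP|apply: sW; left|apply: sW; right].
by apply/asboolP; split=> // _ [->|->].
Qed.

Lemma induced_path G W W' x p : W `<=` W' ->
  path (adj (induced G W)) x p -> path (adj (induced G W')) x p.
Proof.
move=> WW'; apply: sub_path => u v /adj_induced[uv Wu Wv].
by apply/adj_induced; split=> //; exact: WW'.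
Qed.

Lemma induced_path_adj G W x p :
  path (adj (induced G W)) x p -> path (adj G) x p.
Proof. by apply: sub_path => u v /adj_induced[]. Qed.

Definition conn G W := W `<=` vertices G /\ connected_graph (induced G W).

Definition boundary G W := [set v | ~ W v /\ exists2 u, W u & adj G u v].

Lemma conn_nonempty G W : conn G W -> exists x, W x.
Proof. by move=> [_ [[x [_ Wx]] _]]; exists x. Qed.

Lemma conn_path G W x y : conn G W -> W x -> W y ->
  exists2 p, path (adj (induced G W)) x p & y = last x p.
Proof. by move=> [WV [_ cW]] Wx Wy; apply: cW; split=> //; exact: WV. Qed.

Lemma conn_sub G W A x : conn G W -> W x -> A x ->
  (forall u v, W u -> A u -> W v -> adj G u v -> A v) -> W `<=` A.
Proof.
move=> cW Wx Ax clA y Wy; have [p xp ->] := conn_path cW Wx Wy.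
by apply: path_stay xp Ax => u v Au /adj_induced[uv Wu Wv]; exact: clA uv.
Qed.

Lemma conn_exit G W A x y : conn G W -> W x -> A x -> W y -> ~ A y ->
  exists u v, [/\ W u, A u, W v, ~ A v & adj G u v].
Proof.
move=> cW Wx Ax Wy; have [p xp ->] := conn_path cW Wx Wy => nAy.
have [u [v [Au nAv /adj_induced[uv Wu Wv]]]] := path_exit xp Ax nAy.
by exists u, v.
Qed.

Lemma conn_avoid_boundary G W A x : conn G W -> W x -> A x ->
  W `&` boundary G A = set0 -> W `<=` A.
Proof.
move=> cW Wx Ax WA0; apply: (conn_sub cW Wx Ax) => u v Wu Au Wv uv.
apply: contrapT => nAv; have : (W `&` boundary G A) v by split=> //; split=> //; exists u.
by rewrite WA0.
Qed.

Lemma boundary_vertices G W : boundary G W `<=` vertices G.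
Proof. by move=> v [_ [u _ uv]]; have [] := adj_vertices uv. Qed.

Lemma conn_set1 G x : vertices G x -> conn G [set x].
Proof.
move=> Gx; split=> [_ -> //|]; split; first by exists x.
by move=> _ _ [_ ->] [_ ->]; exists [::].
Qed.

Lemma conn_setU1 G W x y : conn G W -> W x -> adj G x y -> conn G (W `|` [set y]).
Proof.
move=> cW Wx xy; have [_ Gy] := adj_vertices xy; set W' := W `|` [set y].
have xy' : adj (induced G W') x y by apply/adj_induced; split=> //; [left|right].
have reach z : W' z -> exists2 p, path (adj (induced G W')) x p & z = last x p.
  move=> [Wz|->]; last by exists [:: y] => //=; rewrite xy'.
  have [p xp zE] := conn_path cW Wx Wz; exists p => //.
  by apply: induced_path xp; exact: subsetUl.
have sym : symmetric (adj (induced G W')) by exact: adj_sym.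
split; first by move=> z [Wz|-> //]; exact: (proj1 cW).
split; first by exists x; split; [exact: (proj1 cW)|left].
move=> u v [_ /reach[p xp uE]] [_ /reach[q xq vE]].
have lastE : last u (rev (belast x p)) = x.
  by case: p uE {xp} => [->|a p _] //=; rewrite rev_cons last_rcons.
exists (rev (belast x p) ++ q); last by rewrite last_cat lastE.
rewrite cat_path lastE xq andbT uE rev_path.
by rewrite (@eq_path _ _ (adj (induced G W'))) // => a b; rewrite sym.
Qed.

(** The path is added to X vertex by vertex. *)
Lemma conn_grow_path G W X x p : conn G X -> finite_set X -> X `<=` W -> X x ->
  path (adj (induced G W)) x p ->
  exists X', [/\ conn G X', finite_set X', X' `<=` W, X `<=` X' & X' (last x p)].
Proof.
elim: p x X => [|y p IH] x X cX fX XW Xx /=.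
  by exists X; split=> //; exact: subset_refl.
move=> /andP[/adj_induced[xy Wx Wy] yp].
have [||||X' [cX' fX' X'W XX' X'l]] := IH y (X `|` [set y]) _ _ _ _ yp.
- exact: conn_setU1 Xx xy.
- by rewrite finite_setU.
- by move=> z [/XW|->].
- by right.
by exists X'; split=> // z Xz; apply: XX'; left.
Qed.

(** The set is grown along paths of W, one boundary vertex at a time. *)
Lemma conn_touch G W F : conn G W -> finite_set F -> F `<=` boundary G W ->
  exists X, [/\ conn G X, finite_set X, X `<=` W &
    forall v, F v -> exists2 u, X u & adj G u v].
Proof.
move=> cW /(@finite_seqP {classic T})[s ->].
have [x0 Wx0] := conn_nonempty cW; elim: s => [_|v s IH sW].
  exists [set x0]; split=> // [|_ -> //].
  by apply: conn_set1; exact: (proj1 cW).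
have [|X [cX fX XW Xs]] := IH.
  by move=> w ws; apply: sW; rewrite /= inE ws orbT.
have [_ [u Wu uv]] : boundary G W v by apply: sW; rewrite /= inE eqxx.
have [x Xx] := conn_nonempty cX.
have [p xp uE] := conn_path cW (XW _ Xx) Wu.
have [X' [cX' fX' X'W XX' X'u]] := conn_grow_path cX fX XW Xx xp.
exists X'; split=> // w; rewrite /= inE => /orP[/eqP ->|/Xs[z Xz zw]].
  by exists u => //; rewrite uE.
by exists z => //; exact: XX'.
Qed.

End Connectedness.

Section Components.
Context {T : Type} (G : graph T).
Implicit Types (C D : graph T) (F W : set T) (r s : nat -> T).

Lemma component_vertices F C : component (delete G F) C ->
  vertices C `<=` vertices G `\` F.
Proof. by move=> [[VC _] _ _] x /VC. Qed.

Lemma component_adj_closed F C u v : component (delete G F) C ->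
  vertices C u -> adj G u v -> ~ F v -> vertices C v.
Proof.
move=> cC Cu uv nFv; have [Gu nFu] := component_vertices cC Cu.
have [_ Gv] := adj_vertices uv.
rewrite (component_unique cC Cu); split=> //; exists [:: v] => //=.
by rewrite andbT; apply/adj_induced.
Qed.

Lemma component_conn F C : component (delete G F) C -> conn G (vertices C).
Proof.
move=> cC; have [sC cnC _] := cC; have VC := component_vertices cC.
split=> [x /VC[]//|]; split=> [|x y [_ Cx] [_ Cy]].
  by have [x Cx] := cnC.1; exists x; split=> //; have [] := VC _ Cx.
have [p xp yE] := cnC.2 _ _ Cx Cy; exists p => //.
apply: sub_path xp => a b ab; have [Ca Cb] := adj_vertices ab.
apply/adj_induced; split=> //.
by move/asboolP: ab => /sC.2[? _]; apply/asboolP.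
Qed.

Lemma component_boundary F C : component (delete G F) C ->
  boundary G (vertices C) `<=` F.
Proof.
move=> cC v [nCv [u Cu uv]]; apply: contrapT => nFv.
by apply: nCv; exact: component_adj_closed uv nFv.
Qed.

(** Components are graphs of their own, with their own edges; this reduces rays
in them to rays of G whose vertices they contain. *)
Lemma component_ray F C r : component (delete G F) C ->
  ray C r <-> ray G r /\ forall i, vertices C (r i).
Proof.
move=> cC; split=> [rC|[[ri rE] rC]].
  split=> [|i]; last exact: ray_vertices rC.
  have [sC _ _] := cC; apply: sub_ray rC; apply: subgraph_trans sC _.
  by split=> [x []|e []].
split=> // i; rewrite (component_unique cC (rC i)).
have Cv j : vertices (component_of (delete G F) (r i)) (r j).
  by rewrite -(component_unique cC (rC i)).
split; last by move=> _ [->|->]; [have [] := Cv i|have [] := Cv i.+1].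
split=> // _ [->|->]; exact: (component_vertices cC (rC _)).2.
Qed.

Lemma ray_tail n r : ray G r -> ray G (tail n r).
Proof.
move=> [ri rE]; split=> [i j /ri /addnI //|i].
by rewrite /tail addnS; exact: rE.
Qed.

Lemma end_ray (e : end_space G) r : end_rays e r -> ray G r.
Proof. by have [r0 _ ->] := end_raysP e; case. Qed.

Lemma ray_has_end r : ray G r -> exists e : end_space G, end_rays e r.
Proof.
move=> rG; have eP : is_end G [set s | ray G s /\ ray_equiv G r s] by exists r.
exists (End eP); split=> // F fF _.
have [n rn] := ray_tail_delete rG fF.
exists (component_of (delete G F) (tail n r 0)).
have rn' := ray_in_component rn.
by split; [apply: component_ofP; exact: ray_vertices rn|exists n|exists n].
Qed.

End Components.

Lemma end_rays_tail T (G : graph T) (e : end_space G) n r :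
  end_rays e r -> end_rays e (tail n r).
Proof.
have [r0 r0G ->] := end_raysP e; move=> [rG r0r]; split; first exact: ray_tail.
move=> F fF FV; have [C [cC r0C [k rC]]] := r0r F fF FV.
exists C; split=> //; exists k.
have -> : tail k (tail n r) = tail n (tail k r).
  by apply/funext => i; rewrite /tail addnCA.
exact: ray_tail.
Qed.

(** * Rays from infinite walks *)

Section Rays.
Context {T : eqType} (G : graph T).

(** After visiting a vertex, jump to its last occurrence in the walk and continue
from there: no vertex is met twice. *)
Lemma loop_erasure (w : nat -> T) : (forall i, adj G (w i) (w i.+1)) ->
  (forall v, exists M, forall i, M <= i -> w i <> v) ->
  exists2 t : nat -> nat, ray G (w \o t) & forall n, n <= t n.
Proof.
move=> wE wfin.
have /choice[l lP] i : exists j,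
    [/\ i <= j, w j = w i & forall k, j < k -> w k <> w i].
  have [M MP] := wfin (w i).
  have ex0 : exists j, `[< w j = w i >] by exists i; apply/asboolP.
  have ub j : `[< w j = w i >] -> j <= M.
    by move=> /asboolP ji; rewrite leqNgt; apply/negP => /ltnW/MP.
  exists (ex_maxn ex0 ub); case: ex_maxnP => j /asboolP ji jmax; split=> //.
    by apply: jmax; apply/asboolP.
  by move=> k jk ki; have := jmax k (asboolT ki); rewrite leqNgt jk.
pose t := fix t n := if n is n'.+1 then l (t n').+1 else l 0.
have tlast n k : t n < k -> w k <> w (t n).
  by case: n => [|n] /=; [have [_ ->] := lP 0|have [_ ->] := lP (t n).+1]; apply.
have tS n : t n < t n.+1 by have [] := lP (t n).+1.
have tmono m n : m < n -> t m < t n.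
  elim: n => // n IH; rewrite ltnS leq_eqVlt => /orP[/eqP ->//|/IH mn].
  exact: ltn_trans (tS n).
exists t; last by elim=> // n IH; exact: leq_ltn_trans (tS n).
split=> [m n /= mn|n /=].
  by case: (ltngtP m n) => // /tmono/tlast; rewrite mn.
by apply/asboolP; have [_ -> _] := lP (t n).+1; exact: wE.
Qed.

(** The concatenation of the paths is an infinite walk that meets each vertex
finitely often, so its loops can be erased. *)
Lemma ray_along_paths (a : nat -> T) (p : nat -> seq T) :
  (forall m, path (adj G) (a m) (p m)) ->
  (forall m, last (a m) (p m) = a m.+1) ->
  (forall m, p m <> [::]) ->
  (forall v, exists M, forall m, M <= m -> v \notin p m) ->
  exists2 r, ray G r &
    forall n, exists k, forall i, k <= i -> exists2 m, n <= m & r i \in p m.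
Proof.
move=> pP pl pn0 pfin.
(* W n is the concatenation of the first n paths, w their limit *)
pose W := fix W n := if n is n'.+1 then W n' ++ p n' else [::].
have WP n : path (adj G) (a 0) (W n) /\ last (a 0) (W n) = a n.
  by elim: n => // n [IH1 IH2] /=; rewrite cat_path last_cat IH2 IH1 pP pl.
have Wsize n : n <= size (W n).
  elim: n => // n IH /=; rewrite size_cat -addn1 leq_add //.
  by case: (p n) (pn0 n).
have Wcat m n : m <= n -> exists q, W n = W m ++ q.
  elim: n => [|n IH]; first by rewrite leqn0 => /eqP ->; exists [::].
  rewrite leq_eqVlt => /orP[/eqP ->|/IH[q qE]]; first by exists [::]; rewrite cats0.
  by exists (q ++ p n); rewrite /= qE catA.
pose w i := nth (a 0) (W i.+1) i.
have wE n i : i < size (W n) -> w i = nth (a 0) (W n) i.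
  move=> lti; have [/Wcat[q qE]|/ltnW/Wcat[q qE]] := leqP i.+1 n.
    by rewrite qE nth_cat Wsize.
  by rewrite /w qE nth_cat lti.
have Wblock n m i : size (W n) <= i < size (W m) ->
    exists2 k, n <= k & nth (a 0) (W m) i \in p k.
  elim: m => [|m IH]; first by rewrite andbC ltn0.
  rewrite /= nth_cat size_cat => /andP[ni im]; case: ifP => [lti|/negbT].
    by apply: IH; rewrite ni.
  rewrite -leqNgt => mi; exists m; last by rewrite mem_nth // ltn_subLR.
  rewrite leqNgt; apply/negP => /Wcat[q qE]; move: ni.
  by rewrite qE /= !size_cat leqNgt (leq_trans im) // leq_addr.
have wblock n i : size (W n) <= i -> exists2 m, n <= m & w i \in p m.
  by move=> ni; apply: Wblock; rewrite ni Wsize.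
have wadj i : adj G (w i) (w i.+1).
  have [/(pathP (a 0))/(_ i.+1 (Wsize _)) + _] := WP i.+2.
  by rewrite (wE _ _ (Wsize i.+2)) (wE _ _ (ltnW (Wsize i.+2))).
have wfin v : exists M, forall i, M <= i -> w i <> v.
  have [M MP] := pfin v; exists (size (W M)) => i /wblock[m Mm + wv].
  by rewrite wv; apply/negP; exact: MP.
have [t tray tn] := loop_erasure wadj wfin.
exists (w \o t) => // n; exists (size (W n)) => i ni.
by apply: wblock; exact: leq_trans (tn i).
Qed.

End Rays.

(** * Descending sequences of connected sets *)

Lemma finite_trace_stable (T : choiceType) (C : nat -> set T) (F : set T) :
  finite_set F -> (forall m n, m <= n -> C n `<=` C m) ->
  exists n, forall x, F x -> C n x -> forall m, C m x.
Proof.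
move=> /finite_seqP[s ->] Cdec; elim: s => [|x s [n nP]]; first by exists 0.
have [k kP] : exists k, C k x -> forall m, C m x.
  have [Kx|/existsNP[k nCk]] := pselect (forall m, C m x); first by exists 0.
  by exists k.
exists (maxn k n) => y; rewrite /= inE => /orP[/eqP ->|sy] Cy.
  by apply: kP; exact: Cdec (leq_maxl _ _) _ Cy.
by apply: nP => //; exact: Cdec (leq_maxr _ _) _ Cy.
Qed.

(** A term of maximal cardinality contains all later ones. *)
Lemma bounded_increasing_stable (T : choiceType) (L : nat -> set T) (B : set T)
  n : finite_set B -> (forall i j, i <= j -> L i `<=` L j) ->
  (forall m, n <= m -> L m #<= B) ->
  exists2 M, n <= M & forall j, M <= j -> L j `<=` L M.
Proof.
move=> /[dup] fB /finite_setP[k Bk] Linc LB.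
have fL m : n <= m -> finite_set (L m) by move=> /LB /card_le_finite; exact.
pose P c := `[< exists2 m, n <= m & #|` fset_set (L m)| = c >].
have exP : exists c, P c.
  by exists #|` fset_set (L n)|; apply/asboolP; exists n.
have ubP c : P c -> c <= k.
  move=> /asboolP[m nm <-]; apply: geq_card_fset_set.
  by rewrite -(card_le_eqr Bk); exact: LB.
case: (ex_maxnP exP ubP) => c /asboolP[M nM cM] cmax.
exists M => // j Mj; have nj := leq_trans nM Mj.
have sub : (fset_set (L M) `<=` fset_set (L j))%fset.
  apply/fsubsetP => x; rewrite !in_fset_set ?inE; [|exact: fL..].
  exact: Linc.
have /eqP E : fset_set (L M) == fset_set (L j).
  rewrite eqEfcard sub /= cM; apply: cmax; apply/asboolP.
  by exists j.
by move=> x; rewrite -(fset_setK (fL _ nM)) -(fset_setK (fL _ nj)) E.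
Qed.

Section Descent.
Context {T : choiceType} (G : graph T).
Variables C X : nat -> set T.
Hypothesis connC : forall m, conn G (C m).
Hypothesis connX : forall m, conn G (X m).
Hypothesis XC : forall m, X m `<=` C m.
Hypothesis CX : forall m, C m.+1 `<=` C m `\` X m.
Hypothesis touchX : forall m v, boundary G (C m) v ->
  exists2 u, X m u & adj G u v.

Lemma descent_decr m n : m <= n -> C n `<=` C m.
Proof.
elim: n => [|n IH]; first by rewrite leqn0 => /eqP ->.
rewrite leq_eqVlt => /orP[/eqP -> //|/IH nm x /CX[Cx _]]; exact: nm.
Qed.

(** A path of C m towards C m.+1 stops at a boundary vertex of C m.+1, which
X m.+1 touches; the rest of the way is inside X m.+1. The region C m minus
C m.+2 is chosen so that a vertex occurs in at most two of these paths. *)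
Lemma descent_link m x y : X m x -> X m.+1 y ->
  exists2 p, path (adj (induced G (C m `\` C m.+2))) x p & y = last x p.
Proof.
set H := induced G _ => Xx Xy.
pose A := [set z | (C m `\` C m.+1) z /\
  exists2 p, path (adj H) x p & z = last x p].
have Cx := XC Xx; have Cy : C m y by apply: (descent_decr (leqnSn m)); exact: XC.
have Ax : A x by split; [split=> // /CX[]|exists [::]].
have nAy : ~ A y by move=> [[_ nCy] _]; exact: nCy (XC Xy).
have [u [v [Cu [[_ nCu] [p xp uE]] Cv nAv uv]]] :=
  conn_exit (connC m) Cx Ax Cy nAy.
have C2 z : C m.+2 z -> C m.+1 z by apply: descent_decr.
have Cv1 : C m.+1 v.
  apply: contrapT => nCv; apply: nAv; split=> //.
  exists (rcons p v); last by rewrite last_rcons.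
  rewrite rcons_path xp -uE; apply/adj_induced.
  by split=> //; split=> // /C2.
have [z Xz zu] : exists2 z, X m.+1 z & adj G z u.
  by apply: touchX; split=> //; exists v => //; rewrite adj_sym.
have XH : X m.+1 `<=` C m `\` C m.+2.
  by move=> t Xt; split=> [|/CX[]//]; apply: (descent_decr (leqnSn m)); exact: XC.
have [q zq yE] := conn_path (connX m.+1) Xz Xy.
exists (p ++ z :: q); last by rewrite last_cat.
rewrite cat_path xp -uE /=; apply/andP; split.
  apply/adj_induced; rewrite adj_sym; split=> //; last exact: XH.
  by split=> // /C2.
exact: induced_path zq.
Qed.

(** The links between successive X m run in C m minus C m.+2, a region that a
finite set F misses for large m because each vertex of F leaves the sequence C
once or never. So beyond some m all links and all X m stay together in
[delete G F], as soon as the ray along the links shares a component with them. *)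
Lemma descent_ray : exists2 r, ray G r &
  forall F Q, finite_set F -> component (delete G F) Q ->
    (exists n, forall i, n <= i -> vertices Q (r i)) ->
    exists n, forall m, n <= m -> X m `<=` vertices Q.
Proof.
have /choice[a aP] m : exists x, X m x by apply: conn_nonempty (connX m).
have /choice[p pP] m : exists p,
    path (adj (induced G (C m `\` C m.+2))) (a m) p /\ a m.+1 = last (a m) p.
  by have [p] := descent_link (aP m) (aP m.+1); exists p.
have p_in m v : v \in p m -> (C m `\` C m.+2) v.
  move=> vp; have [+ _] := pP m; case/splitPr: vp => p1 p2.
  by rewrite cat_path => /andP[_ /= /andP[/adj_induced[]]].
have trace F : finite_set F ->
    exists n, forall x, F x -> C n x -> forall m, C m x.
  by move=> fF; apply: finite_trace_stable => //; exact: descent_decr.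
have [||||r rG rp] := @ray_along_paths _ G a p.
- by move=> m; have [mP _] := pP m; exact: induced_path_adj mP.
- by move=> m; have [_ ->] := pP m.
- move=> m pm0; have [_] := pP m; rewrite pm0 /= => aE.
  have [_] : (C m `\` X m) (a m) by apply: CX; rewrite -aE; exact: XC.
  exact.
- move=> v; have [M MP] := trace [set v] (finite_set1 v).
  exists M => m Mm; apply/negP => /p_in[Cv]; apply.
  by apply: MP => //; exact: descent_decr Cv.
exists r => // F Q fF cQ [n rQ]; have [N NP] := trace F fF.
have nF m x : N <= m -> C m x -> F x -> forall j, C j x.
  by move=> Nm Cx Fx; apply: NP => //; exact: descent_decr Cx.
have stay m u v : N <= m -> vertices Q u ->
    adj (induced G (C m `\` C m.+2)) u v -> vertices Q v.
  move=> Nm Qu /adj_induced[uv _ [Cv nCv]].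
  by apply: component_adj_closed cQ Qu uv _ => // /(nF _ _ Nm Cv).
have [k kP] := rp N; have [m Nm rm] := kP (maxn k n) (leq_maxl _ _).
have Qr := rQ _ (leq_maxr k n).
have Qa : vertices Q (a m.+1).
  have [] := pP m; case/splitPr: rm => p1 p2.
  rewrite cat_path last_cat /= => /andP[_ /andP[_ p2P]] ->.
  by apply: path_stay p2P Qr => u v; exact: stay.
have Qaj j : vertices Q (a (m.+1 + j)).
  elim: j => [|j IH]; first by rewrite addn0.
  rewrite addnS; have [jP ->] := pP (m.+1 + j).
  apply: path_stay jP IH => u v; apply: stay.
  by rewrite addSn ltnW // ltnS (leq_trans Nm) // leq_addr.
exists m.+1 => j mj; have Nj : N <= j by exact: leq_trans Nm (ltnW mj).
have Qj : vertices Q (a j) by rewrite -(subnKC mj); exact: Qaj.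
apply: (conn_sub (connX j) (aP j) Qj) => u v Xu Qu Xv uv.
apply: component_adj_closed cQ Qu uv _ => // /(nF _ _ Nj (XC Xv)) /(_ j.+1).
by move=> /CX[].
Qed.

End Descent.

(** * Splitting against locality *)

Section Escape.
Context {T : choiceType} (G : graph T).
Variable bad : set T -> Prop.

Hypothesis bad_split : forall W F, bad W -> W `<=` vertices G ->
  finite_set (boundary G W) -> finite_set F -> F `<=` vertices G ->
  exists D, [/\ conn G D, bad D, D `<=` W `\` F &
                boundary G D `<=` boundary G W `|` F].

Hypothesis end_not_bad : forall r, ray G r -> exists F,
  [/\ finite_set F, F `<=` vertices G &
      forall Q, component (delete G F) Q ->
        (exists n, forall i, n <= i -> vertices Q (r i)) ->
        forall D, D `<=` vertices Q -> ~ bad D].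

Definition bad_region W := [/\ conn G W, bad W & finite_set (boundary G W)].

(** The set touching the boundary of W is chosen first; among the bad regions of
W that avoid it, one with fewest boundary vertices is taken. *)
Lemma bad_region_step W : bad_region W -> exists XD : set T * set T,
  [/\ conn G XD.1, XD.1 `<=` W,
      forall v, boundary G W v -> exists2 u, XD.1 u & adj G u v,
      bad_region XD.2 /\ XD.2 `<=` W `\` XD.1 &
      forall D, bad_region D -> D `<=` W `\` XD.1 ->
        boundary G XD.2 #<= boundary G D].
Proof.
move=> [cW bW fW].
have [X [cX fX XW Xt]] := conn_touch cW fW (@subset_refl _ _).
have [D0 [cD0 bD0 D0W D0b]] :=
  bad_split bW (proj1 cW) fW fX (proj1 cX).
pose I := {D | bad_region D /\ D `<=` W `\` X}.
have D0P : bad_region D0 /\ D0 `<=` W `\` X.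
  split=> //; split=> //; apply: sub_finite_set D0b _.
  by rewrite finite_setU.
have [[D DP] /= Dmin] :=
  exists_card_min (exist _ _ D0P : I) (fun D => boundary G (sval D)).
exists (X, D); split=> //= D' bD' D'W.
exact: Dmin (exist _ D' (conj bD' D'W)).
Qed.

(** The contradiction between splitting and locality, for an arbitrary predicate
in place of not being small. *)
Lemma not_bad_vertices : ~ bad (vertices G).
Proof.
move=> badV.
have bV : boundary G (vertices G) = set0.
  by apply/seteqP; split=> // v [nGv [u _ uv]]; have [] := adj_vertices uv.
have [C0 bC0] : exists C0, bad_region C0.
  have [|||D [cD bD _ Db]] := bad_split badV _ _ (finite_set0 T).
  - exact: subset_refl.
  - by rewrite bV.
  - by [].
  by exists D; split=> //; apply: sub_finite_set Db _; rewrite bV setU0.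
have /choice[f fP] W : exists XD : set T * set T, bad_region W ->
    [/\ conn G XD.1, XD.1 `<=` W,
      forall v, boundary G W v -> exists2 u, XD.1 u & adj G u v,
      bad_region XD.2 /\ XD.2 `<=` W `\` XD.1 &
      forall D, bad_region D -> D `<=` W `\` XD.1 ->
        boundary G XD.2 #<= boundary G D].
  have [bW|nbW] := pselect (bad_region W); last by exists (W, W).
  by have [XD] := bad_region_step bW; exists XD.
pose C m := iter m (fun W => (f W).2) C0; pose X m := (f (C m)).1.
have bC m : bad_region (C m).
  by elim: m => // m IH; have [_ _ _ []] := fP _ IH.
have connC m : conn G (C m) by have [] := bC m.
have connX m : conn G (X m) by have [] := fP _ (bC m).
have XC m : X m `<=` C m by have [] := fP _ (bC m).
have touchX m v : boundary G (C m) v -> exists2 u, X m u & adj G u v.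
  by have [_ _ + _ _] := fP _ (bC m); apply.
have CX m : C m.+1 `<=` C m `\` X m by have [_ _ _ []] := fP _ (bC m).
have Cmin m D : bad_region D -> D `<=` C m `\` X m ->
    boundary G (C m.+1) #<= boundary G D.
  by have [_ _ _ _] := fP _ (bC m); apply.
have decr := descent_decr CX.
have [r rG rX] := descent_ray connC connX XC CX touchX.
have [F [fF FV Fbad]] := end_not_bad rG.
have [k0 rk0] := ray_tail_delete rG fF.
set Q := component_of (delete G F) (tail k0 r 0).
have cQ : component (delete G F) Q.
  by apply: component_ofP; exact: ray_vertices rk0.
have Qr : exists n, forall i, n <= i -> vertices Q (r i).
  exists k0 => i ki; rewrite -(subnKC ki).
  exact: (ray_vertices (i - k0) (ray_in_component rk0)).
have {}Fbad := Fbad Q cQ Qr.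
have [n1 n1P] := rX F Q fF cQ Qr.
have [n2 n2P] := finite_trace_stable fF decr.
pose n := maxn n1 n2.
have XQ m : n <= m -> X m `<=` vertices Q.
  by move=> nm; apply: n1P; exact: leq_trans (leq_maxl _ _) nm.
have Fn x : F x -> C n x -> forall m, C m x.
  by move=> Fx Cx; apply: n2P => //; apply: decr Cx; exact: leq_maxr.
have [cCn bCn fCn] := bC n.
have [D [cD bD DC Db]] := bad_split bCn (proj1 cCn) fCn fF FV.
(* D is connected and avoids F, and it is not contained in Q *)
have DQ x : D x -> ~ vertices Q x.
  move=> Dx Qx; apply: (Fbad D) => //.
  apply: (conn_sub cD Dx Qx) => u v Du Qu /DC[_ nFv] uv.
  exact: component_adj_closed cQ Qu uv nFv.
have Dbd m v : n <= m -> D v -> ~ boundary G (C m) v.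
  move=> nm Dv /touchX[u /(XQ _ nm) Qu uv]; apply: (DQ v Dv).
  by apply: component_adj_closed cQ Qu uv _ => //; have [] := DC v Dv.
have [d Dd] := conn_nonempty cD.
have [an Xan] := conn_nonempty (connX n).
have nDan : ~ D an by move=> /DQ; apply; exact: XQ Xan.
have [u [b [_ Du Cb nDb ub]]] :=
  conn_exit cCn (proj1 (DC d Dd)) Dd (XC n an Xan) nDan.
have Kb : forall m, C m b.
  have [|[//]|Fb] := Db b; first by split=> //; exists u.
  exact: Fn.
(* b lies in every C m and its neighbour u in D is not on their boundaries *)
have DCm m : n <= m -> D `<=` C m.
  move=> nm; have Cu : C m u.
    apply: contrapT => nCu; apply: (Dbd m u nm Du); split=> //.
    by exists b => //; rewrite adj_sym.
  apply: (conn_avoid_boundary cD Du Cu).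
  by apply/seteqP; split=> // x [/(Dbd _ _ nm)].
have regD : bad_region D.
  by split=> //; apply: sub_finite_set Db _; rewrite finite_setU.
(* D competes with C m for the least boundary *)
have bdD m : n.+1 <= m -> boundary G (C m) #<= boundary G D.
  case: m => // m nm; apply: Cmin => // x Dx; split; first exact: DCm Dx.
  by move=> Xx; apply: (DQ x Dx); exact: XQ Xx.
pose L m := [set v | forall j, m <= j -> boundary G (C j) v].
have [|||M nM ML] := @bounded_increasing_stable _ L (boundary G D) n.+1.
- by have [] := regD.
- by move=> i j ij v Lv k jk; apply: Lv; exact: leq_trans jk.
- move=> m nm; apply: card_le_trans (bdD m nm); apply: subset_card_le.
  by move=> v /(_ m (leqnn m)).
have [a Xa] := conn_nonempty (connX M).
pose K := [set x | forall m, C m x].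
have nKa : ~ K a by move=> /(_ M.+1) /CX[].
have [x [y [_ Kx Cy nKy xy]]] :=
  conn_exit (A := K) (connC M) (Kb M) Kb (XC M a Xa) nKa.
have [j nCy] : exists j, ~ C j y by apply/existsNP.
(* y is outside C i for large i, but adjacent to x, which is in all of them *)
have : L M y.
  apply: (ML (maxn M j) (leq_maxl _ _)) => i Mji; split; last by exists x.
  by move=> /(decr j i (leq_trans (leq_maxr _ _) Mji)).
by move=> /(_ M (leqnn M)) [].
Qed.

End Escape.

(** * Open covers of the end space *)

Section EndCovers.
Context {T : Type} (G : graph T) (kappa : Type).
Hypothesis infkappa : infinite_set [set: kappa].

Definition ray_components (F : set T) : set (graph T) :=
  [set C | component (delete G F) C /\ contains_ray C].

Definition ends_in (W : set T) : set (end_space G) :=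
  [set e | exists2 r, end_rays e r & forall i, W (r i)].

Lemma end_has_ray (e : end_space G) : exists r, end_rays e r.
Proof.
have [r rG eE] := end_raysP e; have [d dr] := ray_has_end rG.
have [s sG dE] := end_raysP d; exists r; rewrite eE; split=> // F fF FV.
have := dr; rewrite dE => -[_ /(_ F fF FV)[C [cC _ rC]]].
by exists C.
Qed.

Lemma components_meet_eq (H C C' : graph T) x : component H C -> component H C' ->
  vertices C x -> vertices C' x -> C = C'.
Proof.
move=> cC cC' Cx C'x.
by rewrite (component_unique cC Cx) (component_unique cC' C'x).
Qed.

Lemma end_component_tail F C (e : end_space G) r n : finite_set F ->
  F `<=` vertices G -> component (delete G F) C -> end_rays e r ->
  (forall i, n <= i -> vertices C (r i)) -> end_component e F C.
Proof.
move=> fF FV cC er Cr; have [C' eC'] := end_component_exists e fF FV.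
have [cC' /(_ r er)[k rC']] := eC'.
suff -> : C = C' by [].
apply: (components_meet_eq cC cC' (x := r (k + n))).
  by apply: Cr; exact: leq_addl.
exact: (ray_vertices n rC').
Qed.

(** The sets of ends in the components of [delete G F] form a partition into open
sets, so a subcover contains the set of every component with a ray. *)
Lemma has_subcovers_ray_components : has_subcovers (end_space G) kappa ->
  forall F, finite_set F -> F `<=` vertices G ->
  ray_components F #<= [set: kappa].
Proof.
move=> Gk F fF FV; pose E (C : graph T) := ends_in (vertices C).
have endE C e : component (delete G F) C -> E C e -> end_component e F C.
  by move=> cC [r er Cr]; apply: (end_component_tail (n := 0) fF FV cC er) => i _.
have [||U' [U'U cU' U'k]] := Gk (E @` ray_components F).
- move=> _ [C [cC _] <-]; rewrite open_endE => e Ee; exists F; split=> // d.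
  move=> [C' eC' [r dr C'r]]; rewrite (end_component_unique (endE _ _ cC Ee) eC').
  by exists r => // i; exact: ray_vertices C'r.
- apply/seteqP; split=> // e _; have [C [cC eC]] := end_component_exists e fF FV.
  have [r er] := end_has_ray e; have [n Cr] := eC r er.
  exists (E C); first by exists C => //; split=> //; exists (tail n r).
  by exists (tail n r); [exact: end_rays_tail|move=> i; exact: ray_vertices Cr].
have EU' C : ray_components F C -> exists e, E C e /\ U' (E C).
  move=> [cC [r Cr]]; have [rG Cri] := (component_ray r cC).1 Cr.
  have [e er] := ray_has_end rG; have Ee : E C e by exists r.
  exists e; split=> //; have [A U'A Ae] : (\bigcup_(A in U') A) e by rewrite cU'.
  have [C' [cC' _] AE] := U'U A U'A; subst A.
  by rewrite (end_component_unique (endE _ _ cC Ee) (endE _ _ cC' Ae)).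
apply: card_le_trans U'k; apply: (card_le_map (f := E)).
  by move=> C /EU'[e []].
move=> C C'; rewrite !inE => rC rC' EE; have [e [Ee _]] := EU' C rC.
have Ee' : E C' e by rewrite -EE.
by have [[cC _] [cC' _]] := (rC, rC');
  exact: end_component_unique (endE _ _ cC Ee) (endE _ _ cC' Ee').
Qed.

Section Cover.
Variable U : set (set (end_space G)).

Definition small (W : set T) := exists U' : set (set (end_space G)),
  [/\ U' `<=` U, U' #<= [set: kappa] & ends_in W `<=` \bigcup_(A in U') A].

(** Every end of W has a ray in a component of the graph minus F and the boundary
of W that is contained in W. If those were all small, the union of their at
most kappa covers, each of size at most kappa, would show that W is small. *)
Lemma not_small_split W F :
  ray_components (boundary G W `|` F) #<= [set: kappa] ->
  ~ small W -> finite_set (boundary G W) -> finite_set F ->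
  exists D, [/\ conn G D, ~ small D, D `<=` W `\` F &
                boundary G D `<=` boundary G W `|` F].
Proof.
set F' := _ `|` F => F'k nW fW fF.
have fF' : finite_set F' by rewrite finite_setU.
apply: contrapT => noD.
have smallC C : ray_components F' C -> vertices C `<=` W -> small (vertices C).
  move=> [cC _] CW; apply: contrapT => nC; apply: noD; exists (vertices C).
  split=> //; [exact: component_conn cC| |exact: component_boundary cC].
  move=> x Cx; split; first exact: CW.
  by move=> Fx; have [_] := component_vertices cC Cx; apply; right.
have /choice[V VP] C : exists U' : set (set (end_space G)),
    [/\ U' `<=` U, U' #<= [set: kappa] &
      ray_components F' C -> vertices C `<=` W ->
      ends_in (vertices C) `<=` \bigcup_(A in U') A].
  have [[rC CW]|nC] := pselect (ray_components F' C /\ vertices C `<=` W).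
    by have [U' [U'U U'k CU']] := smallC C rC CW; exists U'.
  by exists set0; split=> [A []||rC CW]; [exact: card_ge0|case: nC].
apply: nW; exists (\bigcup_(C in ray_components F') V C); split.
- by move=> A [C _ VA]; have [+ _ _] := VP C; apply.
- by apply: card_bigcup_le => // C _; have [] := VP C.
move=> e [r er Wr]; have [n rn] := ray_tail_delete (end_ray er) fF'.
set C := component_of (delete G F') (tail n r 0).
have rC : ray C (tail n r) := ray_in_component rn.
have cC : component (delete G F') C.
  by apply: component_ofP; exact: ray_vertices rn.
have FC : ray_components F' C by split=> //; exists (tail n r).
have CW : vertices C `<=` W.
  apply: (conn_avoid_boundary (component_conn cC) (ray_vertices 0 rC) (Wr _)).
  apply/seteqP; split=> // x [Cx bx]; have [_] := component_vertices cC Cx.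
  by apply; left.
have [_ _ /(_ FC CW)CV] := VP C.
have [|A VA Ae] := CV e; last by exists A => //; exists C.
by exists (tail n r); [exact: end_rays_tail|move=> i; exact: ray_vertices rC].
Qed.

(** If the member A of the cover contains the end of r and its neighbourhood
given by F, then A alone covers the ends in the component Q of the tails of r. *)
Lemma ray_leaves_not_small r :
  (forall A, U A -> open A) -> \bigcup_(A in U) A = setT -> ray G r ->
  exists F, [/\ finite_set F, F `<=` vertices G &
      forall Q, component (delete G F) Q ->
        (exists n, forall i, n <= i -> vertices Q (r i)) ->
        forall D, D `<=` vertices Q -> ~ ~ small D].
Proof.
move=> oU cU rG; have [e er] := ray_has_end rG.
have [A UA Ae] : (\bigcup_(A in U) A) e by rewrite cU.
have [F [fF FV FA]] : exists F,
    [/\ finite_set F, F `<=` vertices G & end_nbhd e F `<=` A].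
  by have := oU A UA; rewrite open_endE; apply.
exists F; split=> // Q cQ [n Qr] D DQ nD; apply: nD.
exists [set A]; split; first by move=> _ ->.
  have [x _] := infinite_setN0 infkappa.
  by apply: (card_le_map (f := fun=> x)) => // B B'; rewrite !inE => -> ->.
move=> d [s ds Ds]; exists A => //; apply: FA.
exists Q; first exact: end_component_tail Qr.
exists s => //; apply/(component_ray s cQ); split; first exact: end_ray ds.
by move=> i; exact: DQ.
Qed.

End Cover.

Lemma ray_components_has_subcovers :
  (forall F, finite_set F -> F `<=` vertices G ->
     ray_components F #<= [set: kappa]) ->
  has_subcovers (end_space G) kappa.
Proof.
move=> Gk U oU cU.
have [[U' [U'U U'k U'V]]|nV] := pselect (small U (vertices G)).
  exists U'; split=> //; apply/seteqP; split=> // e _; apply: U'V.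
  have [r er] := end_has_ray e; exists r => // i.
  exact: ray_vertices (end_ray er).
(* [not_bad_vertices] handles finite sets of vertices as sequences *)
exfalso; apply: (@not_bad_vertices {classic T} G (fun W => ~ small U W)) nV.
  move=> W F nW WV fW fF FV; apply: not_small_split => //.
  apply: Gk; first by rewrite finite_setU.
  by move=> x [Wx|Fx]; [exact: boundary_vertices Wx|exact: FV].
by move=> r rG; exact: ray_leaves_not_small.
Qed.

End EndCovers.

Theorem theorem2p3 (T : Type) (G : graph T) (kappa : Type)
    (hkappa : infinite_set [set: kappa]) :
  lindelof_degree_le (end_space G) kappa <->
  (forall F : set T, finite_set F -> F `<=` vertices G ->
     [set C | component (delete G F) C /\ contains_ray C] #<= [set: kappa]).
Proof.
rewrite (lindelof_degree_leE _ hkappa); split.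
  exact: has_subcovers_ray_components.
exact: ray_components_has_subcovers.
Qed.
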